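(* Let $\mathcal{H}$ be a separable infinite-dimensional Hilbert space and let $\{f_n\}_{n=0}^{\infty}\subseteq\mathcal{H}$ be a Bessel sequence consisting of no zero vectors such that $\left\{\frac{f_n}{\|f_n\|}\right\}_{n=0}^\infty$ is also a Bessel sequence. Then $\{f_n\}_{n=0}^{\infty}$ is not a CFC sequence if and only if $\lim_{n\to\infty}\|f_n\|=0$.
   Context: A sequence $\{h_n\}\subseteq\mathcal{H}$ is a Bessel sequence if there is $B>0$ with $\sum_n|\langle f,h_n\rangle|^2\le B\|f\|^2$ for all $f\in\mathcal{H}$. It is a Parseval frame in $\mathcal{H}$ if $\sum_n|\langle f,h_n\rangle|^2=\|f\|^2$ for all $f\in\mathcal{H}$. A sequence $\{f_n\}_{n=0}^\infty\subseteq\mathcal{H}$ is a CFC sequence if there is a bounded linear operator $B\in B(\mathcal{H})$ such that $\{Bf_n\}$ is a Parseval frame in $\mathcal{H}$. *)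

(* Defs.v *)
From HB Require Import structures.
From mathcomp Require Import all_boot all_order all_algebra.
From mathcomp Require Import complex.
From mathcomp Require Import all_classical all_reals.
From mathcomp Require Import topology normedtype sequences.

Set Implicit Arguments.
Unset Strict Implicit.
Unset Printing Implicit Defensive.

Import Order.TTheory GRing.Theory Num.Theory.
Import numFieldNormedType.Exports.

Local Open Scope classical_set_scope.
Local Open Scope ring_scope.

(* Hilbert spaces are taken over the real or the complex numbers; both are
   presented as a [numFieldType] with its conjugation.  Norms of vectors live
   in the scalar field: over the complex numbers [`|x|] is a complex number
   that is real and nonnegative, and [a <= b] means that [b - a] is a
   nonnegative real. *)
Variant scalar_kind := RealScalars | ComplexScalars.

Definition scalars (R : realType) (k : scalar_kind) : numFieldType :=
  match k with RealScalars => R | ComplexScalars => R[i] end.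

Definition scalar_conj (R : realType) (k : scalar_kind) :
    involutive_rmorphism (scalars R k) :=
  match k return involutive_rmorphism (scalars R k) with
  | RealScalars => @idfun R : involutive_rmorphism R
  | ComplexScalars => @Num.conj R[i] : involutive_rmorphism R[i]
  end.

(* Linear in the first argument, conjugate-linear in the second. *)
Notation "{ 'inner_product' H }" := {dot H for @scalar_conj _ _}
  (format "{ 'inner_product'  H }").

Section Frames.
Variables (K : numFieldType) (H : completeNormedModType K) (ip : H -> H -> K).

(* A complete normed module for which this holds is a Hilbert space. *)
Definition induces_norm := forall x : H, `|x| ^+ 2 = ip x x.

Definition separable := exists2 S : set H, countable S & dense S.

Definition finite_dimensional :=
  exists (n : nat) (e : 'I_n -> H), forall x : H,
    exists c : 'I_n -> K, x = \sum_(i < n) c i *: e i.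

Definition coef_series (h : nat -> H) (x : H) : nat -> K :=
  series (fun n => `|ip x (h n)| ^+ 2).

Definition bessel_sequence (h : nat -> H) :=
  exists2 B : K, 0 < B & forall x : H,
    cvgn (coef_series h x) /\ limn (coef_series h x) <= B * `|x| ^+ 2.

Definition parseval_frame (h : nat -> H) :=
  forall x : H, coef_series h x @ \oo --> `|x| ^+ 2.

Definition bounded_operator (T : {linear H -> H}) :=
  exists M : K, forall x : H, `|T x| <= M * `|x|.

Definition cfc_sequence (h : nat -> H) :=
  exists2 T : {linear H -> H}, bounded_operator T &
    parseval_frame (fun n => T (h n)).

End Frames.

(* Main.v *)
Require Import Defs.
From HB Require Import structures.
From mathcomp Require Import all_boot all_order all_algebra.
From mathcomp Require Import complex.
From mathcomp Require Import all_classical all_reals.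
From mathcomp Require Import topology normedtype sequences.
From mathcomp Require Import ring.

Set Implicit Arguments.
Unset Strict Implicit.
Unset Printing Implicit Defensive.

Import Order.TTheory GRing.Theory Num.Theory.
Import numFieldNormedType.Exports.

Local Open Scope classical_set_scope.
Local Open Scope ring_scope.

(** Write [x, y] := sum_n <x, f_n> <f_n, y> = <S x, y> for the energy form of
    the Bessel sequence f, where S is its frame operator.  If T is bounded with
    adjoint A, then sum_n |<x, T f_n>|^2 = [A x, A x]; so f is a CFC sequence
    exactly when some adjointable bounded A satisfies [A x, A x] = |x|^2.  This
    asks the form to be bounded below on an infinite-dimensional subspace, i.e.
    S not to be compact, and the theorem says that compactness of S is decided
    by whether |f_n| tends to 0.

    If |f_n| -> 0, write f_n = |f_n| e_n with (e_n) Bessel.  The synthesis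
    bound of the tail (f_n)_{n >= N}, hence that of (T f_n)_{n >= N}, is as
    small as desired: a Bessel bound on a finite family is the same as a bound
    on the norm of its linear combinations (sum_bessel_synthesis,
    sum_synthesis_bessel).  A nonzero x orthogonal to T f_0, ..., T f_(N-1),
    which exists in infinite dimension, then satisfies
    sum_n |<x, T f_n>|^2 <= |x|^2 / 2, so (T f_n) is not a Parseval frame
    (not_cfc_of_null).

    If |f_n| >= d for infinitely many n, a sequence w is built that is
    orthogonal in H with bounded norms and at the same time orthonormal for
    the energy form (exists_energy_orthonormal).  The next vector is a multiple
    of v = f_n - P f_n, with P the projection onto the span of all the previous
    w_j and S w_j: f_n is weakly null, so P f_n is small for n large, and
    [v, v] >= |<v, f_n>|^2 = |v|^4.  Since H is separable it has a Parseval
    frame u (exists_parseval_frame).  With T y = sum_j <y, w_j> u_j and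
    A x = sum_j <x, u_j> w_j one gets <x, T f_n> = <A x, f_n>, hence
    sum_n |<x, T f_n>|^2 = [A x, A x] = sum_j |<x, u_j>|^2 = |x|^2
    (cfc_of_not_null). *)

(** * Scalars and limits of scalar sequences *)

(** Convergence phrased with norms only, so that a limit found in the
    real field can be transported to the complex one. *)
Lemma is_cvgn_dist (K : numFieldType) (u : nat -> K) :
  (exists l : K, forall e : K, 0 < e -> \forall n \near \oo, `|l - u n| < e) ->
  cvgn u.
Proof.
by move=> [l ul]; apply: (cvgP l); apply/cvgrPdist_lt => e e0; exact: ul.
Qed.

Section Scalars.
Variables (R : realType) (k : scalar_kind).
Local Notation K := (scalars R k).
Implicit Types (a z : K) (u : nat -> K).

Lemma mul_scalar_conj z : z * scalar_conj R k z = `|z| ^+ 2.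
Proof.
case: k z => z /=; first by rewrite real_normK ?num_real ?expr2.
by rewrite normCK.
Qed.

Lemma norm_scalar_conj z : `|scalar_conj R k z| = `|z|.
Proof. by case: k z => z //=; rewrite norm_conjC. Qed.

Lemma scalar_sqrt a : 0 <= a -> exists2 b : K, 0 <= b & b ^+ 2 = a.
Proof.
case: k a => a a0.
- by exists (Num.sqrt a); [exact: sqrtr_ge0|exact: sqr_sqrtr].
- by exists (sqrtC a); [rewrite sqrtC_ge0|exact: sqrtCK].
Qed.

(** Over the complex numbers, the order forces the terms to be real, so the
    statement reduces to the real one applied to real parts. *)
Lemma scalar_nondecreasing_is_cvgn u (B : K) :
  (forall n, 0 <= u n <= B) -> {homo u : m n / (m <= n)%N >-> m <= n} -> cvgn u.
Proof.
case: k u B => u B uB und.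
  apply: (@nondecreasing_is_cvgn R) => //.
  by exists B => _ [n _ <-]; have /andP[] := uB n.
apply: is_cvgn_dist.
move: u B uB und; rewrite /= => u B uB und.
pose v n := complex.Re (u n).
have uE n : u n = (v n)%:C%C.
  have /andP[] := uB n; rewrite /v; case: (u n) => a b /=.
  by rewrite lecE /= => /andP[/eqP -> _].
have vcvg : cvgn v.
  apply: nondecreasing_is_cvgn.
    by move=> m n mn; have := und _ _ mn; rewrite !uE lecR.
  exists (complex.Re B) => _ [n _ <-].
  by have /andP[_] := uB n; rewrite lecE => /andP[_].
exists (limn v)%:C%C => e e0.
have eE : e = (complex.Re e)%:C%C.
  by move: e0; case: (e) => a b; rewrite ltcE /= => /andP[/eqP -> _].
have e'0 : 0 < complex.Re e by move: e0; rewrite eE ltcR.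
have /cvgrPdist_lt /(_ _ e'0) := vcvg.
apply: filterS => n ven.
rewrite uE eE -raddfB /= normc_def /= expr0n /= addr0 sqrtr_sqr.
by rewrite ltcR.
Qed.

End Scalars.

(** A numeric field is only partially ordered, but the limit of [`|u n|] is
    both [`|l|] and [l]. *)
Lemma cvgn_ge0 (K : numFieldType) (u : nat -> K) (l : K) :
  (forall n, 0 <= u n) -> u @ \oo --> l -> 0 <= l.
Proof.
move=> u0 ul; suff -> : l = `|l| by [].
apply: (cvg_unique (@norm_hausdorff _ K^o) ul).
have -> : u = (fun n => `|u n|) by apply/funext => n; rewrite ger0_norm.
exact: (@cvg_norm K K^o).
Qed.

Lemma cvgn_near_le (K : numFieldType) (u : nat -> K) (l b : K) :
  (\forall n \near \oo, u n <= b) -> u @ \oo --> l -> l <= b.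
Proof.
move=> [N _ ub] ul; rewrite -subr_ge0.
apply: (@cvgn_ge0 _ (fun n => b - u (n + N)%N)).
  by move=> n; rewrite subr_ge0 ub //= leq_addl.
by apply: cvgB; [exact: cvg_cst|rewrite (cvg_shiftn N)].
Qed.

Lemma nondecreasing_cvgn_le_lim (K : numFieldType) (u : nat -> K) (l : K) n :
  {homo u : m n / (m <= n)%N >-> m <= n} -> u @ \oo --> l -> u n <= l.
Proof.
move=> und ul; rewrite -lerN2; apply: (@cvgn_near_le _ (fun n => - u n)).
  by exists n => // m /= nm; rewrite lerN2 und.
exact: cvgN.
Qed.

(** The difference of the two sides is [c^-1 * (c * p - q) ^+ 2]. *)
Lemma young_ineq (K : numFieldType) (c p q : K) : 0 < c -> 0 <= p -> 0 <= q ->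
  (p * q) *+ 2 <= c * p ^+ 2 + c^-1 * q ^+ 2.
Proof.
move=> c0 p0 q0; rewrite -subr_ge0.
have -> : c * p ^+ 2 + c^-1 * q ^+ 2 - (p * q) *+ 2 = c^-1 * (c * p - q) ^+ 2.
  by field; rewrite gt_eqF.
have c1 : 0 <= c^-1 by rewrite invr_ge0 ltW.
apply: mulr_ge0 => //; apply: real_exprn_even_ge0 => //.
by rewrite rpredB // ger0_real // mulr_ge0 // ltW.
Qed.
(** * Inner products and the analysis-synthesis duality *)

Section InnerProduct.
Variables (R : realType) (k : scalar_kind).
Local Notation K := (scalars R k).
Local Notation conj := (scalar_conj R k).
Variables (H : completeNormedModType K) (ip : {inner_product H}).
Hypothesis ip_norm : induces_norm ip.
Implicit Types (x y z : H) (a b c : K) (h : nat -> H).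
Implicit Types G F : seq H.

Lemma ipC x y : ip x y = conj (ip y x).
Proof. by rewrite hermC expr0 mul1r. Qed.

Lemma ip_conj x y : ip x y * ip y x = `|ip x y| ^+ 2.
Proof. by rewrite [ip y x]ipC mul_scalar_conj. Qed.

Lemma norm_ipC x y : `|ip x y| = `|ip y x|.
Proof. by rewrite ipC norm_scalar_conj. Qed.

Lemma ip_eq0C x y : ip x y = 0 -> ip y x = 0.
Proof. by move=> xy0; rewrite ipC xy0 rmorph0. Qed.

Lemma ipZl a x y : ip (a *: x) y = a * ip x y.
Proof. exact: linearZl_LR. Qed.

Lemma ipZr a x y : ip x (a *: y) = conj a * ip x y.
Proof. exact: linearZr_LR. Qed.

Lemma ipBl x y z : ip (x - y) z = ip x z - ip y z.
Proof. exact: linearBl. Qed.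

Lemma ipDl x y z : ip (x + y) z = ip x z + ip y z.
Proof. exact: linearDl. Qed.

Lemma ipBr x y z : ip z (x - y) = ip z x - ip z y.
Proof. exact: linearBr. Qed.

Lemma ipDr x y z : ip z (x + y) = ip z x + ip z y.
Proof. exact: linearDr. Qed.

Lemma ip_suml (I : Type) (t : seq I) (E : I -> H) x :
  ip (\sum_(i <- t) E i) x = \sum_(i <- t) ip (E i) x.
Proof. exact: linear_sumlz. Qed.

Lemma ip_sumr (I : Type) (t : seq I) (E : I -> H) x :
  ip x (\sum_(i <- t) E i) = \sum_(i <- t) ip x (E i).
Proof. exact: linear_sumr. Qed.

Lemma normDd x y : ip x y = 0 -> `|x + y| ^+ 2 = `|x| ^+ 2 + `|y| ^+ 2.
Proof.
move=> xy0; have yx0 := ip_eq0C xy0.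
by rewrite !ip_norm ipDl !ipDr xy0 yx0 addr0 add0r.
Qed.

(** Pythagoras for the decomposition of [x] along [y]. *)
Lemma cauchy_schwarz x y : `|ip x y| <= `|x| * `|y|.
Proof.
have [->|y0] := eqVneq y 0; first by rewrite linear0r !normr0 mulr0.
have ny : 0 < `|y| by rewrite normr_gt0.
rewrite -(@ler_pXn2r _ 2) ?nnegrE ?mulr_ge0 // exprMn.
pose c := ip x y / `|y| ^+ 2.
have xcy : ip (x - c *: y) (c *: y) = 0.
  by rewrite ipZr ipBl ipZl -ip_norm divfK ?expf_neq0 ?gt_eqF // subrr mulr0.
have := normDd xcy; rewrite subrK => ->.
rewrite -ler_pdivrMr ?exprn_gt0 // -[leLHS]add0r lerD ?exprn_ge0 //.
rewrite normrZ exprMn /c normf_div normrX normr_id expr_div_n.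
have ny0 : `|y| != 0 by rewrite gt_eqF.
have qn0 : `|y| ^+ 2 != 0 by rewrite expf_neq0.
by move: (`|y| ^+ 2) qn0 => q qn0; rewrite [q ^+ 2]expr2 invfM mulrA divfK.
Qed.

Lemma young_ip c x y : 0 < c ->
  `|ip x y| *+ 2 <= c * `|x| ^+ 2 + c^-1 * `|y| ^+ 2.
Proof.
move=> c0; apply: le_trans (_ : (`|x| * `|y|) *+ 2 <= _).
  by rewrite lerMn2r cauchy_schwarz orbT.
by apply: young_ineq => //; exact: normr_ge0.
Qed.

Lemma cvg_ipl (u : nat -> H) x y :
  u @ \oo --> x -> (fun n => ip (u n) y) @ \oo --> ip x y.
Proof.
move=> /cvgrPdist_lt ux; apply/cvgrPdist_lt => e e0.
have y1 : 0 < `|y| + 1 by rewrite ltr_wpDl.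
have /ux : 0 < e / (`|y| + 1) by rewrite divr_gt0.
apply: filterS => n un; rewrite -ipBl.
apply: le_lt_trans (cauchy_schwarz _ _) _.
move: un; rewrite ltr_pdivlMr //; apply: le_lt_trans.
by rewrite ler_wpM2l // lerDl.
Qed.

Lemma cvg_ipr (u : nat -> H) x y :
  u @ \oo --> x -> (fun n => ip y (u n)) @ \oo --> ip y x.
Proof.
move=> /(@cvg_ipl _ _ y) /cvgrPdist_lt ux; apply/cvgrPdist_lt => e /ux.
by apply: filterS => n; rewrite -ipBr -ipBl norm_ipC.
Qed.

Lemma le_norm_of_sq a x y : 0 <= a -> `|x| ^+ 2 <= a * `|y| ^+ 2 ->
  `|x| <= (a + 1) * `|y|.
Proof.
move=> a0 xy; rewrite -(@ler_pXn2r _ 2) ?nnegrE ?mulr_ge0 ?addr_ge0 //.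
rewrite exprMn; apply: le_trans xy _; apply: ler_wpM2r; first exact: exprn_ge0.
have -> : (a + 1) ^+ 2 = a + (a ^+ 2 + a + 1) by ring.
by rewrite lerDl !addr_ge0 ?exprn_ge0.
Qed.

(** Duality between analysis and synthesis.  With [y] the linear combination,
    [`|y| ^+ 2] is the sum of the [a i * ip (h i) y]; bounding each term by
    [young_ineq] makes half of the right-hand side reproduce [`|y| ^+ 2]. *)
Lemma sum_bessel_synthesis (t : seq nat) h c : 0 < c ->
  (forall x, \sum_(i <- t) `|ip x (h i)| ^+ 2 <= c * `|x| ^+ 2) ->
  forall a : nat -> K,
    `|\sum_(i <- t) a i *: h i| ^+ 2 <= c * \sum_(i <- t) `|a i| ^+ 2.
Proof.
move=> c0 hc a; set y := \sum_(i <- t) _.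
have E : `|y| ^+ 2 *+ 2 <= c * (\sum_(i <- t) `|a i| ^+ 2) + `|y| ^+ 2.
  apply: le_trans (_ : c * (\sum_(i <- t) `|a i| ^+ 2) +
     c^-1 * (\sum_(i <- t) `|ip y (h i)| ^+ 2) <= _); last first.
    by rewrite lerD2l ler_pdivrMl.
  rewrite -[`|y| ^+ 2]ger0_norm ?exprn_ge0 // {1}ip_norm {1}/y ip_suml.
  rewrite !mulr_sumr -big_split /=.
  apply: le_trans (_ : (\sum_(i <- t) `|ip (a i *: h i) y|) *+ 2 <= _).
    by rewrite lerMn2r ler_norm_sum orbT.
  rewrite -sumrMnl; apply: ler_sum => i _.
  rewrite ipZl normrM [`|ip y _|]norm_ipC.
  exact: young_ineq.
by move: E; rewrite mulr2n lerD2r.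
Qed.

(** The converse duality: test the synthesis bound on the coefficients
    [a i = ip x (h i)] of [x] itself, for which [ip x y] is the sum to be
    bounded. *)
Lemma sum_synthesis_bessel (t : seq nat) h c : 0 < c ->
  (forall a : nat -> K,
    `|\sum_(i <- t) a i *: h i| ^+ 2 <= c * \sum_(i <- t) `|a i| ^+ 2) ->
  forall x, \sum_(i <- t) `|ip x (h i)| ^+ 2 <= c * `|x| ^+ 2.
Proof.
move=> c0 hc x; set s := \sum_(i <- t) _.
pose y := \sum_(i <- t) ip x (h i) *: h i.
have s0 : 0 <= s by apply: sumr_ge0 => i _; rewrite exprn_ge0.
have E : ip x y = s.
  rewrite ip_sumr; apply: eq_bigr => i _.
  by rewrite ipZr mulrC mul_scalar_conj.
have yc : c^-1 * `|y| ^+ 2 <= s by rewrite ler_pdivrMl //; exact: hc.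
have : s *+ 2 <= c * `|x| ^+ 2 + s.
  rewrite -{1}(ger0_norm s0) -E; apply: le_trans (young_ip x y c0) _.
  by rewrite lerD2l E.
by rewrite mulr2n lerD2r.
Qed.

(** * Finite orthogonal projections *)

Definition proj G x : H := \sum_(g <- G) ip x g *: g.

(** Such a list is a Parseval frame of its span, on which [proj G] is then the
    orthogonal projection.  Orthonormality would forbid zero entries, which
    make the Gram-Schmidt step total. *)
Definition parseval_list G :=
  forall x g, g \in G -> ip (x - proj G x) g = 0.

Lemma proj_rcons G v x : proj (rcons G v) x = proj G x + ip x v *: v.
Proof. by rewrite /proj big_rcons. Qed.

Lemma ip_proj0 G x y : (forall g, g \in G -> ip x g = 0) -> ip x (proj G y) = 0.
Proof.
move=> xG; rewrite ip_sumr big_seq big1 // => g gG.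
by rewrite ipZr xG // mulr0.
Qed.

(** Bessel's identity: the remainder is orthogonal to the projection. *)
Lemma norm_sub_proj G x : parseval_list G ->
  `|x - proj G x| ^+ 2 = `|x| ^+ 2 - \sum_(g <- G) `|ip x g| ^+ 2.
Proof.
move=> GP; have xP0 : ip (x - proj G x) (proj G x) = 0 by exact/ip_proj0/GP.
have := normDd xP0; rewrite subrK => ->.
rewrite [X in _ = _ + X - _]ip_norm.
move: xP0; rewrite ipBl => /eqP; rewrite subr_eq0 => /eqP <-.
have -> : ip x (proj G x) = \sum_(g <- G) `|ip x g| ^+ 2.
  rewrite ip_sumr; apply: eq_bigr => g _.
  by rewrite ipZr mulrC mul_scalar_conj.
by rewrite addrK.
Qed.

Lemma parseval_list_nil : parseval_list [::].
Proof. by move=> x g. Qed.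

Lemma parseval_list_rcons G v : parseval_list G ->
  (forall g, g \in G -> ip v g = 0) -> v = 0 \/ `|v| = 1 ->
  parseval_list (rcons G v).
Proof.
move=> GP vG v01 x g; rewrite mem_rcons inE proj_rcons opprD addrA ipBl ipZl.
case/orP => [/eqP ->|gG]; last by rewrite GP // vG // mulr0 subr0.
rewrite ipBl [ip (proj G x) v]ipC ip_proj0 // rmorph0 subr0.
case: v01 => [->|v1]; first by rewrite !linear0r mul0r subr0.
by rewrite -ip_norm v1 expr1n mulr1 subrr.
Qed.

(** The new vector is the normalised remainder of [x], or [0] when there is
    no remainder. *)
Lemma gram_schmidt_step G x : parseval_list G ->
  exists2 v, parseval_list (rcons G v) & proj (rcons G v) x = x.
Proof.
move=> GP; pose d := x - proj G x.
have dG : forall g, g \in G -> ip d g = 0 by exact: GP.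
have [d0|d0] := eqVneq d 0.
  exists 0.
    by apply: parseval_list_rcons => // *; [rewrite linear0l|left].
  by rewrite proj_rcons scaler0 addr0; apply/esym/subr0_eq.
have nd0 : `|d| != 0 by rewrite normr_eq0.
exists (`|d|^-1 *: d).
  apply: parseval_list_rcons => // [g gG|]; first by rewrite ipZl dG // mulr0.
  by right; rewrite normrZ normrV ?unitfE // normr_id mulVf.
rewrite proj_rcons ipZr scalerA.
have -> : ip x d = `|d| ^+ 2.
  rewrite ip_norm {1 3}/d ipBl [ip (proj G x) d]ipC ip_proj0 //.
  by rewrite rmorph0 subr0.
have -> : conj `|d|^-1 * `|d| ^+ 2 * `|d|^-1 = conj `|d|^-1 * `|d|.
  by rewrite expr2 mulrA mulfK.
have -> : conj `|d|^-1 = `|d|^-1.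
  have : `|d|^-1 != 0 by rewrite invr_eq0.
  move=> /mulfI; apply.
  by rewrite mul_scalar_conj normrV ?unitfE // normr_id expr2.
by rewrite mulVf // scale1r /d addrC subrK.
Qed.

(** By [norm_sub_proj], enlarging the list can only decrease the remainder. *)
Lemma proj_fixed_rcons G v x : parseval_list G -> parseval_list (rcons G v) ->
  proj G x = x -> proj (rcons G v) x = x.
Proof.
move=> GP GvP Gx; apply/esym/subr0_eq/eqP.
rewrite -normr_eq0 -sqrf_eq0 eq_le exprn_ge0 // andbT.
have := norm_sub_proj x GP; rewrite Gx subrr normr0 expr0n /= => E.
rewrite norm_sub_proj // big_rcons /= opprD addrA -E add0r oppr_le0.
exact: exprn_ge0.
Qed.

Lemma exists_parseval_list F :
  exists2 G, parseval_list G & forall x, x \in F -> proj G x = x.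
Proof.
elim: F => [|y F [G GP GF]].
  by exists [::] => //; exact: parseval_list_nil.
have [v vP vy] := gram_schmidt_step y GP.
exists (rcons G v) => // x; rewrite inE => /orP[/eqP -> //|xF].
exact: proj_fixed_rcons (GF _ xF).
Qed.

Lemma perp_of_fixed G x y : (forall g, g \in G -> ip x g = 0) ->
  proj G y = y -> ip x y = 0.
Proof. by move=> xG <-; exact: ip_proj0. Qed.

(** If no vector had a remainder, the list itself would span the space. *)
Lemma exists_perp F : ~ finite_dimensional H ->
  exists2 x, x != 0 & forall y, y \in F -> ip x y = 0.
Proof.
move=> Hinf; have [G GP GF] := exists_parseval_list F.
have /existsNP[x xG] : ~ forall x, proj G x = x.
  move=> Gid; apply: Hinf; exists (size G), (fun i => nth 0 G i) => x.
  exists (fun i => ip x (nth 0 G i)).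
  by rewrite -{1}(Gid x) /proj (big_nth 0) big_mkord.
exists (x - proj G x).
  by rewrite subr_eq0; apply/eqP => xE; exact/xG/esym.
by move=> y yF; apply: (@perp_of_fixed G); [exact: GP|exact: GF].
Qed.

(** Dependent choice where each new vector depends on the list of all the
    previous ones. *)
Lemma history_choice (P : seq H -> H -> Prop) : (forall G, exists v, P G v) ->
  exists u : nat -> H, forall n, P (mkseq u n) (u n).
Proof.
move=> /choice[c cP].
pose L := fix L n := if n is m.+1 then rcons (L m) (c (L m)) else [::].
exists (fun n => c (L n)) => n.
suff -> : mkseq (fun n => c (L n)) n = L n by exact: cP.
by elim: n => // n IH; rewrite mkseqS IH.
Qed.

(** * Bessel sequences and mixed frame operators *)

Lemma coef_seriesE h x n :
  coef_series ip h x n = \sum_(0 <= i < n) `|ip x (h i)| ^+ 2.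
Proof. by []. Qed.

Lemma coef_series_homo h x :
  {homo coef_series ip h x : m n / (m <= n)%N >-> m <= n}.
Proof.
move=> m n mn; rewrite !coef_seriesE (big_cat_nat (leq0n m) mn) //= lerDl.
by apply: sumr_ge0 => i _; exact: exprn_ge0.
Qed.

Lemma bessel_sum_le h : bessel_sequence ip h ->
  exists2 c : K, 0 < c & forall x m n,
    \sum_(m <= i < n) `|ip x (h i)| ^+ 2 <= c * `|x| ^+ 2.
Proof.
move=> [c c0 hc]; exists c => // x m n.
have [hx hle] := hc x; apply: le_trans hle.
have [nm|mn] := leqP n m.
  rewrite big_geq //; apply: (@cvgn_ge0 _ (coef_series ip h x)) => // i.
  by apply: sumr_ge0 => j _; exact: exprn_ge0.
apply: le_trans (nondecreasing_cvgn_le_lim n (@coef_series_homo h x) hx).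
rewrite coef_seriesE (big_cat_nat (leq0n m) (ltnW mn)) //= lerDr.
by apply: sumr_ge0 => j _; exact: exprn_ge0.
Qed.

Lemma bessel_of_sum_le h c : 0 < c ->
  (forall x n, \sum_(0 <= i < n) `|ip x (h i)| ^+ 2 <= c * `|x| ^+ 2) ->
  bessel_sequence ip h.
Proof.
move=> c0 hc; exists c => // x.
have hx : cvgn (coef_series ip h x).
  apply: (@scalar_nondecreasing_is_cvgn _ _ _ (c * `|x| ^+ 2)).
    by move=> n; rewrite coef_seriesE hc sumr_ge0 // => i _; exact: exprn_ge0.
  exact: coef_series_homo.
split => //; apply: (@cvgn_near_le _ (coef_series ip h x)) => //.
by near=> n; exact: hc.
Unshelve. all: by end_near.
Qed.

(** The terms of a convergent series tend to 0. *)
Lemma bessel_weakly_null h x : bessel_sequence ip h ->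
  (fun n => `|ip (h n) x| ^+ 2) @ \oo --> (0 : K).
Proof.
move=> [c _ /(_ x)[hx _]].
have -> : (fun n => `|ip (h n) x| ^+ 2) = (fun n => `|ip x (h n)| ^+ 2).
  by apply/funext => n; rewrite norm_ipC.
exact: (@cvg_series_cvg_0 K K^o).
Qed.

(** The mixed frame operator [x |-> sum_i <x, g_i> h_i]: analysis by [g]
    followed by synthesis by [h].  For [g = h] it is the frame operator. *)
Definition frame_map g h (x : H) : H :=
  limn (series (fun i => ip x (g i) *: h i)).

Section FrameMap.
Variables g h : nat -> H.
Hypotheses (g_bessel : bessel_sequence ip g) (h_bessel : bessel_sequence ip h).

(** By duality, the synthesis bound of [h] turns the Cauchy property of the
    coefficient series of [g] into that of the vector series. *)
Lemma frame_map_cvg x :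
  series (fun i => ip x (g i) *: h i) @ \oo --> frame_map g h x.
Proof.
suff : cauchy (series (fun i => ip x (g i) *: h i) @ \oo) by exact: cauchy_cvg.
apply/cauchy_seriesP => e e0.
have [c c0 hc] := bessel_sum_le h_bessel.
have [_ _ /(_ x)[gx _]] := g_bessel.
have e20 : 0 < c^-1 * e ^+ 2 by rewrite mulr_gt0 ?invr_gt0 ?exprn_gt0.
have /(@cauchy_seriesP K K^o) /(_ _ e20) : cauchy (coef_series ip g x @ \oo).
  exact: cvg_cauchy.
apply: filterS => -[m n] /= mn.
rewrite -(@ltr_pXn2r _ 2) ?nnegrE ?(ltW e0) //.
apply: le_lt_trans (_ : c * \sum_(m <= i < n) `|ip x (g i)| ^+ 2 < _).
  by apply: sum_bessel_synthesis => // y; exact: hc.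
rewrite -ltr_pdivlMl //; apply: le_lt_trans mn.
by rewrite ger0_norm // sumr_ge0 // => i _; exact: exprn_ge0.
Qed.

Lemma frame_map_cvg_ipl x y :
  series (fun i => ip x (g i) * ip (h i) y) @ \oo --> ip (frame_map g h x) y.
Proof.
have -> : series (fun i => ip x (g i) * ip (h i) y) =
    (fun n => ip (series (fun i => ip x (g i) *: h i) n) y).
  apply/funext => n; rewrite /series /= ip_suml.
  by apply: eq_bigr => i _; rewrite ipZl.
exact/cvg_ipl/frame_map_cvg.
Qed.

Lemma frame_map_cvg_ipr x y :
  series (fun i => conj (ip x (g i)) * ip y (h i)) @ \oo
    --> ip y (frame_map g h x).
Proof.
have -> : series (fun i => conj (ip x (g i)) * ip y (h i)) =
    (fun n => ip y (series (fun i => ip x (g i) *: h i) n)).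
  apply/funext => n; rewrite /series /= ip_sumr.
  by apply: eq_bigr => i _; rewrite ipZr.
exact/cvg_ipr/frame_map_cvg.
Qed.

Lemma frame_map_linear : linear (frame_map g h).
Proof.
move=> a x y.
have := cvg_unique (@norm_hausdorff _ H) (@frame_map_cvg (a *: x + y)).
apply.
have -> : series (fun i => ip (a *: x + y) (g i) *: h i) =
   (fun n => a *: series (fun i => ip x (g i) *: h i) n +
             series (fun i => ip y (g i) *: h i) n).
  apply/funext => n; rewrite scaler_sumr -big_split /=.
  by apply: eq_bigr => i _; rewrite ipDl ipZl scalerDl scalerA.
by apply: cvgD; [apply: cvgZr|]; exact: frame_map_cvg.
Qed.

Lemma frame_map_bounded :
  exists M : K, forall x, `|frame_map g h x| <= M * `|x|.
Proof.
have [cg cg0 gc] := bessel_sum_le g_bessel.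
have [ch ch0 hc] := bessel_sum_le h_bessel.
exists (ch * cg + 1) => x.
apply: (@cvgn_near_le _ _ _ _ _ (@cvg_norm _ _ _ _ _ _ _ (@frame_map_cvg x))).
near=> n; apply: le_norm_of_sq; first by rewrite mulr_ge0 ?ltW.
apply: le_trans (sum_bessel_synthesis ch0 (fun y => hc y 0 n) _) _.
by rewrite -mulrA ler_pM2l // gc.
Unshelve. all: by end_near.
Qed.

Lemma frame_map_operator :
  exists2 T : {linear H -> H}, bounded_operator T & T =1 frame_map g h.
Proof.
pose T : {linear H -> H} := HB.pack (frame_map g h)
  (GRing.isLinear.Build K H H *:%R (frame_map g h) frame_map_linear).
by exists T => //; exact: frame_map_bounded.
Qed.

End FrameMap.

(** Both sides are the limit of the same scalar series, so no representation
    theorem is involved in producing adjoints. *)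
Lemma frame_map_adjoint g h x y :
  bessel_sequence ip g -> bessel_sequence ip h ->
  ip (frame_map g h x) y = ip x (frame_map h g y).
Proof.
move=> gB hB.
have := cvg_unique (@norm_hausdorff _ K^o) (@frame_map_cvg_ipl _ _ gB hB x y).
apply.
have -> : series (fun i => ip x (g i) * ip (h i) y) =
          series (fun i => conj (ip y (h i)) * ip x (g i)).
  by congr series; apply/funext => i; rewrite mulrC -ipC.
exact: frame_map_cvg_ipr.
Qed.

Lemma coef_series_cvg f x : bessel_sequence ip f ->
  coef_series ip f x @ \oo --> ip (frame_map f f x) x.
Proof.
move=> fB; have := @frame_map_cvg_ipl _ _ fB fB x x.
rewrite (_ : series _ = coef_series ip f x) //.
by congr series; apply/funext => i; exact: ip_conj.
Qed.

Lemma sum_mkseq (V : nmodType) (u : nat -> H) (E : H -> V) n :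
  \sum_(y <- mkseq u n) E y = \sum_(0 <= i < n) E (u i).
Proof. by rewrite big_map /index_iota subn0. Qed.

(** * Parseval frames of separable spaces *)

Lemma projB G x y : proj G (x - y) = proj G x - proj G y.
Proof.
rewrite -sumrB; apply: eq_bigr => g _.
by rewrite ipBl scalerBl.
Qed.

(** Gram-Schmidt along a dense sequence [d], each step absorbing the next
    [d n] in the span.  If [d m] is close to [x], then for every [n > m] the
    remainder of [x] equals that of [x - d m], hence is at most
    [`|x - d m|]. *)
Lemma exists_parseval_frame : separable H ->
  exists u : nat -> H, parseval_frame ip u.
Proof.
move=> [S Scount Sdense].
have [d Sd] : exists d : nat -> H, S `<=` range d.
  have [S0|/set0P S0] := eqVneq S set0; first by exists (fun=> 0); rewrite S0.
  have /pfcard_geP[|[d]] := Scount.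
    by move=> E; move: S0; rewrite E => -[].
  by exists d => x /(@surj _ _ _ _ d)[n _ <-]; exists n.
have /history_choice[u uP] : forall G, exists v, parseval_list G ->
    parseval_list (rcons G v) /\ proj (rcons G v) (d (size G)) = d (size G).
  move=> G; have [GP|nGP] := pselect (parseval_list G); last by exists 0.
  by have [v vP vd] := gram_schmidt_step (d (size G)) GP; exists v.
have uPL n : parseval_list (mkseq u n).
  elim: n => [|n IH]; first exact: parseval_list_nil.
  by rewrite mkseqS; exact: (uP n IH).1.
have ud m n : (m < n)%N -> proj (mkseq u n) (d m) = d m.
  elim: n => // n IH; rewrite ltnS leq_eqVlt mkseqS => /orP[/eqP ->|mn].
    by have := (uP n (uPL n)).2; rewrite size_mkseq.
  apply: proj_fixed_rcons => //; last exact: IH.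
  by rewrite -mkseqS.
exists u => x; apply/cvgrPdist_lt => e e0.
have [b b0 be] := scalar_sqrt (ltW e0).
have {}b0 : 0 < b.
  by rewrite lt_neqAle b0 andbT eq_sym; apply: contraTneq e0 => b0';
     rewrite -be b0' expr0n ltxx.
have [z [xz Sz]] : (ball x b)^° `&` S !=set0.
  by apply: Sdense; [exists x; exact: nbhsx_ballx|exact: open_interior].
have [m _ dm] := Sd _ Sz.
have {}xz : `|x - d m| < b.
  by move/interior_subset: xz; rewrite dm -ball_normE.
exists m.+1 => // n /= mn.
have E : `|x - proj (mkseq u n) x| ^+ 2 = `|x| ^+ 2 - coef_series ip u x n.
  by rewrite norm_sub_proj // sum_mkseq.
rewrite -E ger0_norm ?exprn_ge0 // -be.
apply: le_lt_trans (_ : `|x - d m| ^+ 2 < _); last first.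
  by rewrite ltr_pXn2r ?nnegrE ?(ltW b0).
have -> : x - proj (mkseq u n) x = (x - d m) - proj (mkseq u n) (x - d m).
  by rewrite projB (ud m) // opprB addrA subrK.
rewrite norm_sub_proj // gerDl oppr_le0.
by apply: sumr_ge0 => y _; exact: exprn_ge0.
Qed.

(** * Sequences bounded below in norm *)

(** One step of the construction of vectors orthogonal both in [H] and for
    the energy form.  The vector is a multiple of [v = f n - P (f n)], where
    [P] projects onto a space containing [G] and its image under the frame
    operator; [n] is such that [f n] is long while [P (f n)] is short. *)
Lemma frame_step f (d : K) G : bessel_sequence ip f -> 0 < d ->
  (forall N, exists2 n, (N <= n)%N & d <= `|f n|) ->
  exists v, [/\ forall y, y \in G -> ip v y = 0,
    forall y, y \in G -> ip v (frame_map f f y) = 0,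
    ip v (frame_map f f v) = 1 & `|v| ^+ 2 <= 2 / d ^+ 2].
Proof.
move=> fB d0 fd; set S := frame_map f f.
have [F FP FG] := exists_parseval_list (G ++ map S G).
have Pf0 : (fun n => \sum_(y <- F) `|ip (f n) y| ^+ 2) @ \oo --> (0 : K).
  elim: F {FP FG} => [|y F IH].
    by under eq_fun do rewrite big_nil; exact: (@cvg_cst K^o).
  under eq_fun do rewrite big_cons.
  have := @cvgD K K^o _ _ eventually_filter _ _ _ _
    (bessel_weakly_null y fB) IH.
  by rewrite addr0.
have d2 : 0 < d ^+ 2 / 2 by rewrite divr_gt0 ?exprn_gt0.
have /cvgrPdist_lt /(_ _ d2) [N _ PN] := Pf0.
have [n Nn dn] := fd N.
pose v := f n - proj F (f n).
have vF : forall y, y \in F -> ip v y = 0 by exact: FP.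
have v2 : d ^+ 2 / 2 <= `|v| ^+ 2.
  have := PN n Nn; rewrite /= sub0r normrN ger0_norm; last first.
    by apply: sumr_ge0 => y _; exact: exprn_ge0.
  rewrite norm_sub_proj // => /ltW Pn.
  have -> : d ^+ 2 / 2 = d ^+ 2 - d ^+ 2 / 2 by rewrite {2}[d ^+ 2]splitr addrK.
  by apply: lerB => //; rewrite ler_pXn2r ?nnegrE ?(ltW d0).
have vf : ip v (f n) = `|v| ^+ 2.
  by rewrite -[f n](subrK (proj F (f n))) ipDr ip_proj0 // addr0 -ip_norm.
(* A single term of the energy series of [v], the one of index [n], is
   [`|v| ^+ 4]. *)
have q_ge : d ^+ 2 / 2 * `|v| ^+ 2 <= ip (S v) v.
  have := nondecreasing_cvgn_le_lim n.+1 (@coef_series_homo f v)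
    (@coef_series_cvg f v fB).
  apply: le_trans; rewrite coef_seriesE big_nat_recr //= vf.
  rewrite -[leLHS]add0r lerD //.
    by apply: sumr_ge0 => i _; exact: exprn_ge0.
  by rewrite ger0_norm ?exprn_ge0 // [leRHS]expr2 ler_wpM2r // exprn_ge0.
have v20 : 0 < `|v| ^+ 2 by exact: lt_le_trans v2.
have q0 : 0 < ip (S v) v by apply: lt_le_trans q_ge; exact: mulr_gt0.
(* Scaling by [b^-1] normalises the energy, not the norm, of [v]. *)
have [b b0 bq] := scalar_sqrt (ltW q0).
have bn0 : b != 0.
  by apply: contraTneq q0 => b0'; rewrite -bq b0' expr0n ltxx.
have SZ : S (b^-1 *: v) = b^-1 *: S v.
  have := frame_map_linear fB fB b^-1 v 0.
  have S0 : frame_map f f 0 = 0.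
    have := frame_map_linear fB fB (-1) 0 0.
    by rewrite scaler0 addr0 scaleN1r addNr.
  by rewrite S0 !addr0.
have fixed y : y \in G ++ map S G -> ip (b^-1 *: v) y = 0.
  by move=> yG; rewrite ipZl (@perp_of_fixed F v y) ?mulr0 // FG.
exists (b^-1 *: v); split.
- by move=> y yG; apply: fixed; rewrite mem_cat yG.
- by move=> y yG; apply: fixed; rewrite mem_cat map_f // orbT.
- rewrite -frame_map_adjoint // -/S SZ ipZl ipZr mulrA mul_scalar_conj.
  by rewrite normrV ?unitfE // ger0_norm // exprVn -bq mulVf ?expf_neq0.
- rewrite normrZ normrV ?unitfE // [`|b|]ger0_norm // exprMn exprVn bq.
  rewrite ler_pdivrMl // -ler_pdivrMr ?divr_gt0 ?exprn_gt0 //.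
  apply: le_trans q_ge.
  by rewrite invf_div mulrC.
Qed.

(** By Pythagoras the synthesis bound is [c], and duality concludes. *)
Lemma orthogonal_bessel (w : nat -> H) (c : K) : 0 < c ->
  (forall i j, (j < i)%N -> ip (w i) (w j) = 0) ->
  (forall i, `|w i| ^+ 2 <= c) -> bessel_sequence ip w.
Proof.
move=> c0 ww wc; apply: (bessel_of_sum_le c0) => x n.
apply: sum_synthesis_bessel => // a.
elim: n => [|n IH]; first by rewrite !big_geq // normr0 expr0n mulr0.
rewrite !big_nat_recr //= addrC normDd.
  rewrite mulrDr addrC lerD // normrZ exprMn mulrC.
  by rewrite ler_wpM2r ?exprn_ge0.
rewrite ipZl ip_sumr big_nat big1 ?mulr0 // => i /andP[_ ni].
by rewrite ipZr ww // mulr0.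
Qed.

Lemma exists_energy_orthonormal f (d : K) : bessel_sequence ip f -> 0 < d ->
  (forall N, exists2 n, (N <= n)%N & d <= `|f n|) ->
  exists2 w, bessel_sequence ip w &
    forall i j, ip (w i) (frame_map f f (w j)) = (i == j)%:R.
Proof.
move=> fB d0 fd.
have /history_choice[w wP] := fun G => frame_step G fB d0 fd.
have wmem i j : (j < i)%N -> w j \in mkseq w i.
  by move=> ji; apply/mapP; exists j; rewrite ?mem_iota.
exists w.
  have c0 : 0 < 2 / d ^+ 2 by rewrite divr_gt0 ?exprn_gt0.
  apply: (orthogonal_bessel c0) => [i j ji|i].
    by have [/(_ _ (wmem _ _ ji))] := wP i.
  by have [] := wP i.
move=> i j; case: ltngtP => [ij|ji|->].
- rewrite -frame_map_adjoint //; apply: ip_eq0C.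
  by have [_ /(_ _ (wmem _ _ ij))] := wP j.
- by have [_ /(_ _ (wmem _ _ ji))] := wP i.
- by have [] := wP j.
Qed.

Lemma parseval_bessel h : parseval_frame ip h -> bessel_sequence ip h.
Proof.
move=> hP; exists 1 => // x; split; first exact: cvgP (hP x).
rewrite mul1r le_eqVlt; apply/orP; left; apply/eqP.
exact: (cvg_lim (@norm_hausdorff _ K^o)).
Qed.

(** The operator is [T y = sum_j <y, w_j> u_j], the adjoint of
    [A x = sum_j <x, u_j> w_j], with [w] orthonormal for the energy form and
    [u] a Parseval frame of [H]: then [A] carries the norm of [H] to the
    energy. *)
Lemma cfc_of_not_null f (d : K) :
  separable H -> bessel_sequence ip f -> 0 < d ->
  (forall N, exists2 n, (N <= n)%N & d <= `|f n|) -> cfc_sequence ip f.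
Proof.
move=> Hsep fB d0 fd.
have [w wB wS] := exists_energy_orthonormal fB d0 fd.
have [u uP] := exists_parseval_frame Hsep; have uB := parseval_bessel uP.
have [T Tb TE] := frame_map_operator wB uB.
exists T => // x; pose A := frame_map u w x; set S := frame_map f f.
have -> : coef_series ip (fun n => T (f n)) x = coef_series ip f A.
  by congr series; apply/funext => n; rewrite TE -frame_map_adjoint.
(* [S (A x)] has the same coefficients along [w] as [x] along [u]. *)
have SAw j : ip (S A) (w j) = ip x (u j).
  rewrite frame_map_adjoint //.
  have := cvg_unique (@norm_hausdorff _ K^o)
    (@frame_map_cvg_ipl _ _ uB wB x (S (w j))).
  apply; apply: cvg_near_cst; exists j.+1 => // n /= jn.
  rewrite /series /= (bigD1_seq j) ?mem_index_iota ?iota_uniq //=.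
  rewrite wS eqxx mulr1 big1 ?addr0 // => i ij.
  by rewrite wS (negbTE ij) mulr0.
have -> : `|x| ^+ 2 = ip (S A) A; last exact: coef_series_cvg.
have := cvg_unique (@norm_hausdorff _ K^o) (uP x); apply.
have -> : coef_series ip u x =
          series (fun i => conj (ip x (u i)) * ip (S A) (w i)).
  by congr series; apply/funext => i; rewrite SAw mulrC mul_scalar_conj.
exact: frame_map_cvg_ipr.
Qed.

(** * Sequences tending to zero in norm *)

(** The tail of [T f] has a Bessel bound 1/2, which contradicts the Parseval
    identity at a nonzero vector orthogonal to the remaining finitely many
    terms. *)
Lemma not_cfc_of_null f : ~ finite_dimensional H -> (forall n, f n <> 0) ->
  bessel_sequence ip (fun n => `|f n|^-1 *: f n) ->
  `|f n| @[n --> \oo] --> (0 : K) -> ~ cfc_sequence ip f.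
Proof.
move=> Hinf f0 eB fnull [T [M TM] TP].
have nf0 n : `|f n| != 0 by rewrite normr_eq0; apply/eqP.
have M0 : 0 <= M.
  have : 0 <= M * `|f 0%N| by apply: le_trans (TM _); exact: normr_ge0.
  by rewrite pmulr_lge0 // lt_neqAle eq_sym nf0 normr_ge0.
have [c c0 ec] := bessel_sum_le eB.
(* [D * `|f i| ^+ 2] bounds the contribution of index [i] to the synthesis
   bound of [T f]; adding [1] keeps [D] positive when [M = 0]. *)
pose D := (M ^+ 2 + 1) * c.
have D0 : 0 < D by rewrite mulr_gt0 // ltr_wpDl ?exprn_ge0.
pose t := (2 * D)^-1.
have t0 : 0 < t by rewrite invr_gt0 mulr_gt0.
have [N _ fN] : \forall n \near \oo, `|f n| ^+ 2 < t.
  have f2 : (fun n => `|f n| * `|f n|) @ \oo --> (0 * 0 : K).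
    exact: (@cvgM K).
  move: f2; rewrite mul0r => /cvgrPdist_lt /(_ _ t0); apply: filterS => n.
  by rewrite sub0r normrN normrM !normr_id expr2.
have [x x0 xT] := exists_perp (mkseq (T \o f) N) Hinf.
have tail n : \sum_(N <= i < n) `|ip x (T (f i))| ^+ 2 <= 2^-1 * `|x| ^+ 2.
  apply: sum_synthesis_bessel => [|a]; first by rewrite invr_gt0.
  pose y := \sum_(N <= i < n) (a i * `|f i|) *: (`|f i|^-1 *: f i).
  have -> : \sum_(N <= i < n) a i *: T (f i) = T y.
    rewrite /y linear_sum; apply: eq_bigr => i _.
    by rewrite scalerA mulfK // linearZ.
  apply: le_trans (_ : D * \sum_(N <= i < n) `|a i * `|f i| | ^+ 2 <= _).
    apply: le_trans (_ : (M ^+ 2 + 1) * `|y| ^+ 2 <= _).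
      apply: le_trans (_ : M ^+ 2 * `|y| ^+ 2 <= _).
        by rewrite -exprMn ler_pXn2r ?nnegrE // mulr_ge0.
      by rewrite ler_wpM2r ?exprn_ge0 // lerDl.
    rewrite -mulrA ler_pM2l ?ltr_wpDl ?exprn_ge0 //.
    by apply: sum_bessel_synthesis => // z; exact: ec.
  rewrite !mulr_sumr big_nat [leRHS]big_nat; apply: ler_sum => i /andP[Ni _].
  rewrite normrM normr_id exprMn mulrCA mulrC ler_wpM2r ?exprn_ge0 //.
  have -> : 2^-1 = D * t by rewrite /t invfM mulrCA mulfV ?mulr1 // gt_eqF.
  by rewrite ler_pM2l // ltW // fN.
have : `|x| ^+ 2 <= 2^-1 * `|x| ^+ 2.
  apply: (cvgn_near_le _ (TP x)); exists N => // n /= Nn.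
  rewrite coef_seriesE (big_cat_nat (leq0n N) Nn) /= big_nat big1 ?add0r //.
  move=> i /andP[_ iN]; rewrite xT ?normr0 ?expr0n //.
  by apply/mapP; exists i; rewrite ?mem_iota.
have x2 : 0 < `|x| ^+ 2 by rewrite exprn_gt0 // normr_gt0.
by rewrite -ler_pdivrMr // divff ?gt_eqF // invf_ge1 // lern1.
Qed.

End InnerProduct.

Theorem theorem6p1 (R : realType) (k : scalar_kind)
    (H : completeNormedModType (scalars R k))
    (ip : {inner_product H})
    (ip_norm : induces_norm ip)
    (H_separable : separable H)
    (H_infinite_dim : ~ finite_dimensional H)
    (f : nat -> H)
    (f_bessel : bessel_sequence ip f)
    (f_neq0 : forall n : nat, f n <> 0)
    (f_normalized_bessel : bessel_sequence ip (fun n => `|f n|^-1 *: f n)) :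
  ~ cfc_sequence ip f <-> `|f n| @[n --> \oo] --> (0 : scalars R k).
Proof.
split; last exact: not_cfc_of_null.
apply: contra_notP => /cvgrPdist_lt.
move=> /existsNP[d /not_implyP[d0 fd]].
apply: (cfc_of_not_null ip_norm H_separable f_bessel d0) => N.
apply: contrapT => noN; apply: fd; exists N => // n /= Nn.
rewrite sub0r normrN normr_id real_ltNge ?ger0_real ?(ltW d0) //.
by apply/negP => dn; apply: noN; exists n.
Qed.
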